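(* If $J$ is a residually finite Jónsson algebra, then $|J|\leq 2^{2^{\omega}}$. If moreover $J$ is defined in a finite language, then $|J|\leq 2^{\omega}$.
   Context: A Jónsson algebra is an infinite algebra $J$ in a countable algebraic language which has no proper subalgebra of the same cardinality as $J$. An algebra is residually finite if for any two distinct elements there is a congruence of finite index separating them. *)

(* Defs.v *)
From mathcomp Require Import all_boot.
From mathcomp Require Import boolp classical_sets functions cardinality.
From Stdlib Require RelationClasses.

Set Implicit Arguments.
Unset Strict Implicit.
Unset Printing Implicit Defensive.

Local Open Scope classical_set_scope.
Local Open Scope card_scope.

(* Only operation symbols, of finite arity; constants have arity 0. *)
Record language := Language {
  symbol : Type;
  arity : symbol -> nat
}.

Definition countable_language (L : language) : Prop :=
  countable [set: symbol L].

Definition finite_language (L : language) : Prop :=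
  finite_set [set: symbol L].

Record algebra (L : language) := Algebra {
  carrier :> Type;
  op : forall s : symbol L, ('I_(arity s) -> carrier) -> carrier
}.

(* Subalgebras are represented by their universes. *)
Definition subalgebra (L : language) (J : algebra L) (S : set J) : Prop :=
  forall (s : symbol L) (x : 'I_(arity s) -> J),
    (forall i, S (x i)) -> S (op x).

Definition congruence (L : language) (J : algebra L)
    (E : J -> J -> Prop) : Prop :=
  RelationClasses.Equivalence E /\
  forall (s : symbol L) (x y : 'I_(arity s) -> J),
    (forall i, E (x i) (y i)) -> E (op x) (op y).

Definition finite_index (T : Type) (E : T -> T -> Prop) : Prop :=
  finite_set (range (fun x : T => [set y | E x y])).

Definition residually_finite (L : language) (J : algebra L) : Prop :=
  forall x y : J, x <> y ->
    exists E : J -> J -> Prop,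
      [/\ congruence E, finite_index E & ~ E x y].

Definition jonsson (L : language) (J : algebra L) : Prop :=
  [/\ countable_language L,
      infinite_set [set: J] &
      ~ exists S : set J,
          [/\ subalgebra S, S `<` [set: J] & S #= [set: J]]].

(* Main.v *)
(** Suppose that [f_0, ..., f_n] are distinct homomorphisms from [J] onto the
    same algebra with at most [n] elements. By the pigeonhole principle [J] is
    the union of the equalizers of pairs of them; as [J] is infinite, one of
    these finitely many equalizers has cardinality [|J|], and being a subalgebra
    it is all of [J], a contradiction. So there are only finitely many
    homomorphisms onto each finite algebra. Up to isomorphism there are at most
    [2 ^ omega] finite algebras, and countably many when the language is finite.
    As [J] is residually finite, the values of all these homomorphisms at a
    point determine it. *)
Require Import Defs.
From mathcomp Require Import all_boot.
From mathcomp Require Import boolp classical_sets functions cardinality.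

Set Implicit Arguments.
Unset Strict Implicit.
Unset Printing Implicit Defensive.

Local Open Scope classical_set_scope.
Local Open Scope card_scope.

(** * Absorption for infinite unions *)

Definition jointly_injective (I T : Type) (F : set I) (a : I -> nat -> T) :=
  forall p q i j, F p -> F q -> a p i = a q j -> p = q /\ i = j.

(* Each sequence [b p] is split into three sequences, which are mapped onto
   [a p], onto [b p] and onto what is left of [A]; other points are fixed. *)
Lemma card_setU_le_sequences (I T : Type) (F : set I) (a b : I -> nat -> T)
    (A B : set T) :
  F !=set0 -> (forall p i, F p -> B (b p i)) -> jointly_injective F b ->
  countable (A `\` [set x | exists p i, F p /\ a p i = x]) ->
  A `|` B #<= B.
Proof.
move=> [p0 Fp0] Bb binj; set C := _ `\` _ => /pfcard_geP Cnat.
have [c Cc] : exists c : nat -> T, C `<=` range c.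
  case: Cnat => [->|[c]]; first by exists (b p0) => x [].
  by exists c; apply: (@surj _ _ _ _ c).
pose decode p m := match unpickle m : option (nat + nat + nat) with
  | Some (inl (inl i)) => a p i | Some (inl (inr i)) => b p i
  | Some (inr i) => c i | None => b p 0 end.
(* Joint injectivity makes [D] well defined: a term of some [b p] determines both [p] and its
   index. *)
have /choice[D HD] : forall y, exists z,
    (forall p m, F p -> b p m = y -> z = decode p m) /\
    (~ (exists p m, F p /\ b p m = y) -> z = y).
  move=> y; have [[p [m [Fp <-]]]|N] := pselect (exists p m, F p /\ b p m = y).
    exists (decode p m); split=> [q k Fq e|[]]; last by exists p, m.
    by have [-> ->] := binj _ _ _ _ Fq Fp e.
  by exists y; split=> // p m Fp e; case: N; exists p, m.
have Db p m : F p -> D (b p m) = decode p m.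
  by move=> Fp; have [/(_ p m Fp erefl)] := HD (b p m).
apply: card_le_trans (card_image_le D B); apply: subset_card_le => x ABx.
have [[p [i [Fp bx]]]|xNb] := pselect (exists p i, F p /\ b p i = x).
  exists (b p (pickle (inl (inr i) : nat + nat + nat))); first exact: Bb.
  by rewrite Db// /decode pickleK.
have [[p [i [Fp ax]]]|xNa] := pselect (exists p i, F p /\ a p i = x).
  exists (b p (pickle (inl (inl i) : nat + nat + nat))); first exact: Bb.
  by rewrite Db// /decode pickleK.
case: ABx => [Ax|Bx]; last by exists x => //; have [_ ->] := HD x.
have [i _ cx] : range c x by apply: Cc.
exists (b p0 (pickle (inr i : nat + nat + nat))); first exact: Bb.
by rewrite Db// /decode pickleK.
Qed.

Lemma infinite_set_injection (T : Type) (A : set T) :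
  infinite_set A -> exists2 t : nat -> T, injective t & forall i, A (t i).
Proof.
elim/Ppointed: T A => T A; first by rewrite emptyE => /infinite_setN0[].
move=> /infiniteP/ppcard_leP[f]; exists f => [i j /inj|i]; last exact: funS.
by apply; rewrite inE.
Qed.

(** If [F] is empty, then [A] is finite, so [B] is infinite and a single injective sequence in [B]
    serves as the family. *)
Lemma card_setU_le_finite_rest (I T : Type) (F : set I) (a b : I -> nat -> T)
    (A B : set T) :
  infinite_set (A `|` B) -> (forall p i, F p -> B (b p i)) ->
  jointly_injective F b ->
  finite_set (A `\` [set x | exists p i, F p /\ a p i = x]) ->
  A `|` B #<= B.
Proof.
move=> ABinf Bb binj Cfin; have [F0|/set0P F0] := eqVneq F set0; last first.
  apply: (@card_setU_le_sequences _ _ F a b) => //.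
  exact: finite_set_countable.
have Afin : finite_set A.
  apply: sub_finite_set Cfin => x Ax; split=> // -[p [i []]].
  by rewrite F0.
have [t tinj tB] : exists2 t : nat -> T, injective t & forall i, B (t i).
  apply: infinite_set_injection => Bfin; apply: ABinf.
  by rewrite finite_setU.
apply: (@card_setU_le_sequences unit T setT (fun=> t) (fun=> t)) => //.
- by exists tt.
- by move=> [] [] i j _ _ /tinj ->.
- by apply: finite_set_countable; apply: finite_setD.
Qed.

(* Zorn's lemma is applied to families of pairs of sequences, one in [A] and one
   in [B]: what a maximal family leaves out is finite in [A] or in [B]. This
   gives comparability of [A] and [B] and the absorption law at once. *)
Lemma infinite_card_setU (T : Type) (A B : set T) :
  infinite_set (A `|` B) -> A `|` B #<= A \/ A `|` B #<= B.
Proof.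
move=> ABinf; pose u (p : nat -> T * T) i := (p i).1.
pose v (p : nat -> T * T) i := (p i).2.
pose P (F : set (nat -> T * T)) := [/\ forall p i, F p -> A (u p i) /\ B (v p i),
  jointly_injective F u & jointly_injective F v].
have [|F [[FAB uinj vinj] Fmax]] := @Zorn_bigcup _ P.
  move=> E EP Etot.
  have pair p q : (\bigcup_(X in E) X) p -> (\bigcup_(X in E) X) q ->
      exists2 X, E X & X p /\ X q.
    move=> [X EX Xp] [Y EY Yq]; case: (Etot X Y EX EY) => XY.
      by exists Y => //; split=> //; exact: XY.
    by exists X => //; split=> //; exact: XY.
  split=> [p i [X EX Xp]|p q i j Up Uq|p q i j Up Uq].
  - by have [+ _ _] := EP _ EX; apply.
  - by have [X /EP[_ + _] [Xp Xq]] := pair p q Up Uq; apply.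
  - by have [X /EP[_ _ +] [Xp Xq]] := pair p q Up Uq; apply.
set CA := A `\` [set x | exists p i, F p /\ u p i = x].
set CB := B `\` [set x | exists p i, F p /\ v p i = x].
(* If both remainders were infinite, injective sequences in them, paired, would enlarge [F]. *)
have [CAfin|CBfin] : finite_set CA \/ finite_set CB.
  apply: contrapT => /not_orP[/infinite_set_injection[s sinj sC]].
  move=> /infinite_set_injection[t tinj tC].
  pose p i := (s i, t i).
  have Fp : ~ F p by move=> Fp; have [_ []] := sC 0; exists p, 0.
  apply: (Fmax (F `|` [set p])).
    by split=> [|/(_ p)]; [exact: subsetUl|move=> /(_ (or_intror erefl))].
  split=> [q i [/FAB//|->]|q r i j|q r i j].
  - by split; [case: (sC i)|case: (tC i)].
  - move=> [Fq|->] [Fr|->]; first exact: uinj.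
    + by move=> e; have [_ []] := sC j; exists q, i.
    + by move=> e; have [_ []] := sC i; exists r, j.
    + by move=> /sinj ->.
  - move=> [Fq|->] [Fr|->]; first exact: vinj.
    + by move=> e; have [_ []] := tC j; exists q, i.
    + by move=> e; have [_ []] := tC i; exists r, j.
    + by move=> /tinj ->.
- right; apply: (@card_setU_le_finite_rest _ _ F u v) => // p i.
  by move=> /(FAB _ i)[].
- left; rewrite setUC; apply: (@card_setU_le_finite_rest _ _ F v u) => //.
    by rewrite setUC.
  by move=> p i /(FAB _ i)[].
Qed.

(** Cut along [A i], [X] has a piece of full size; if it is the piece outside [A i], the remaining
    sets cover it. *)
Lemma infinite_card_finite_cover (T : Type) (I : eqType) (s : seq I)
    (A : I -> set T) (X : set T) :
  infinite_set X -> (forall x, X x -> exists2 i, i \in s & A i x) ->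
  exists2 i, i \in s & X #<= A i.
Proof.
elim: s X => [|i s IHs] X Xinf Xcov.
  by have [x /Xcov[]] := infinite_setN0 Xinf.
have := @infinite_card_setU T (X `&` A i) (X `\` A i); rewrite setUIDK.
case=> // XA.
  exists i; first exact: mem_head.
  exact: card_le_trans XA (subset_card_le (@subIsetr _ _ _)).
have [|x [Xx xNi]|j js XAj] := IHs (X `\` A i).
- by move=> /(card_le_finite XA).
- by have [j /predU1P[->//|]] := Xcov _ Xx; exists j.
- by exists j; rewrite ?in_cons ?js ?orbT//; exact: card_le_trans XAj.
Qed.

(** * Homomorphisms to finite algebras *)

Section Homomorphisms.
Variables (L : language) (J : algebra L) (c : symbol L -> nat).

Let cell := (nat * seq nat * nat)%type.

Definition op_graph (f : J -> nat) : set cell :=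
  [set w | exists s (x : 'I_(arity s) -> J),
     w = (c s, [seq f (x i) | i <- enum 'I_(arity s)], f (op x))].

(* Homomorphisms to the algebra with at most [n] elements and graph [G]; the
   target algebra is represented by the graph of its operations only. *)
Definition hom_set n (G : set cell) : set (J -> nat) :=
  [set f | [/\ forall x, f x < n, congruence (fun x y => f x = f y)
             & op_graph f = G]].

Hypothesis cinj : injective c.

(** The shared graph gives [f (op x) = g (op x')] with [g] agreeing on [x] and [x'] coordinatewise;
    the congruence of [g] replaces [x'] by [x]. *)
Lemma equalizer_subalgebra n G f g :
  hom_set n G f -> hom_set n G g -> subalgebra [set x | f x = g x].
Proof.
move=> [_ _ fG] [_ [_ gop] gG] s x /= fgx.
have : op_graph f (c s, [seq f (x i) | i <- enum 'I_(arity s)], f (op x)).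
  by exists s, x.
rewrite fG -gG => -[s' [x' []]] /cinj ss'; subst s' => /eq_in_map e ->.
by apply: gop => i; rewrite -fgx -e ?mem_enum.
Qed.

Hypothesis hJ : jonsson J.

Lemma hom_set_finite n G : finite_set (hom_set n G).
Proof.
have [_ Jinf Jsub] := hJ.
apply: contrapT => /infinite_set_injection[f finj fG].
pose s := [seq p <- allpairs pair (iota 0 n.+1) (iota 0 n.+1) | p.1 != p.2].
pose E (p : nat * nat) : set J := [set x | f p.1 x = f p.2 x].
have [x _|[i j]] := @infinite_card_finite_cover J _ s E _ Jinf.
  apply: contrapT => sN.
  (* Outside all equalizers, [n.+1] maps take distinct values at [x], all below [n]. *)
  have inj : {in `I_n.+1 &, injective (f^~ x)}.
    move=> i j; rewrite !inE/= => ilt jlt fij; apply: contrapT => /eqP ij.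
    apply: sN; exists (i, j) => //; rewrite mem_filter; apply/andP; split=> //.
    by apply: allpairs_f; rewrite mem_iota.
  suff : `I_n.+1 #<= `I_n by rewrite card_le_II ltnn.
  rewrite -(card_le_eql (inj_card_eq inj)); apply: subset_card_le => _ [i _ <-].
  by have [+ _ _] := fG i; apply.
rewrite mem_filter/= => /andP[ij _] JE.
apply: Jsub; exists (E (i, j)); split.
- exact: equalizer_subalgebra (fG i) (fG j).
- split=> // /(_ _ I) Eij; case/eqP: ij.
  by apply: finj; apply/funext => x; exact: Eij.
- by rewrite card_eq_le JE andbT card_leT.
Qed.

Hypothesis hrf : residually_finite J.

Lemma hom_set_separates x y : x <> y ->
  exists n f, hom_set n (op_graph f) f /\ f x <> f y.
Proof.
move=> /hrf[E [[Eeq Eop] /finite_set_leP[n /pcard_leP[g]] NE]].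
(* The quotient map by [E], with the classes numbered below [n]. *)
pose cl z := [set y | E z y]; exists n, (g \o cl).
have clE z w : cl z = cl w <-> E z w.
  have [Er Es Et] := Eeq; split=> [e|zw].
    by have : cl w w by []; rewrite -e.
  apply/seteqP; split=> t; apply: Et => //; exact: Es.
have gE z w : g (cl z) = g (cl w) <-> E z w.
  rewrite -clE; split=> [|->//] /inj; apply; rewrite inE; exact: imageT.
split; last by move=> /gE.
split=> //.
- by move=> z; have := @funS _ _ _ _ g (cl z); apply; exists z.
- split; first by split=> [z|z w|z w t] //= -> .
  by move=> s z w /= zw; apply/gE/Eop => i; apply/gE/zw.
Qed.

(* [K] is a type of codes for finite algebras: all sets of cells in general, and
   the countably many finite lists of cells when the language is finite. *)
Lemma card_le_set_of_code (K Y : Type) (G : K -> set cell)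
    (e : nat * K * nat * nat -> Y) :
  injective e ->
  (forall n f, hom_set n (op_graph f) f -> exists k, op_graph f = G k) ->
  [set: J] #<= [set: set Y].
Proof.
move=> einj Gsurj.
have /choice[d dinj] : forall nk : nat * K, exists d : (J -> nat) -> nat,
    {in hom_set nk.1 (G nk.2) &, injective d}.
  by move=> nk; apply/countable_injP/finite_set_countable/hom_set_finite.
(* The number [d (n, k) f] stands for [f] among the finitely many homomorphisms with this bound and
   graph. *)
pose Phi x := [set y | exists n k f,
  hom_set n (G k) f /\ y = e (n, k, d (n, k) f, f x)].
apply/pcard_injP; exists Phi => x y _ _ xy; apply: contrapT.
move=> /hom_set_separates[n [f [nf]]]; apply.
have [k fk] := Gsurj _ _ nf; rewrite fk in nf.
have : Phi x (e (n, k, d (n, k) f, f x)) by exists n, k, f.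
rewrite xy => -[m [l [g [mg /einj[nm kl]]]]]; subst m l => dfg ->.
by rewrite (dinj (n, k) f g) ?inE.
Qed.

Lemma op_graph_finite n f :
  finite_language L -> (forall x, f x < n) -> finite_set (op_graph f).
Proof.
move=> Lfin fn.
pose H s (p : {ffun 'I_(arity s) -> 'I_n} * 'I_n) : cell :=
  (c s, [seq val (p.1 i) | i <- enum 'I_(arity s)], val p.2).
apply: (@sub_finite_set _ _ (\bigcup_(s in [set: symbol L]) range (@H s))).
  move=> _ [s [x ->]]; exists s => //.
  exists ([ffun i => Ordinal (fn (x i))], Ordinal (fn (op x))) => //.
  by congr (_, _, _); apply: eq_map => i; rewrite ffunE.
by apply: bigcup_finite => // s _; apply: finite_image; exact: finite_finset.
Qed.

End Homomorphisms.

Theorem theorem2p5 (L : language) (J : algebra L)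
  (hJ : jonsson J) (hrf : residually_finite J) :
  [set: J] #<= [set: set (set nat)] /\
  (finite_language L -> [set: J] #<= [set: set nat]).
Proof.
have [/pcard_injP[c cinj0] _ _] := hJ.
have cinj : injective c by move=> s t; apply: cinj0; rewrite inE.
split=> [|Lfin].
  (* The left summand stores the three numbers, the right one the graph, so that one set of numbers
     determines all four components. *)
  pose code (w : nat * nat * nat + nat * seq nat * nat) := pickle w.
  pose e (q : nat * set (nat * seq nat * nat) * nat * nat) : set nat :=
    [set m | exists w, m = code w /\
      match w with inl t => t = (q.1.1.1, q.1.2, q.2) | inr g => q.1.1.2 g end].
  apply: (@card_le_set_of_code L J c cinj hJ hrf _ _ id e); last first.
    by move=> n f _; exists (op_graph c f).
  have cI : injective code by exact: pcan_inj pickleK.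
  have eE q w : e q (code w) <->
      match w with inl t => t = (q.1.1.1, q.1.2, q.2) | inr g => q.1.1.2 g end.
    by split=> [[w' [/cI <-]]|] //; exists w.
  move=> [[[n G] k] v] [[[n' G'] k'] v'] e12.
  have /= [-> -> ->] : (n, k, v) = (n', k', v').
    by apply/(eE (n', G', k', v') (inl _)); rewrite -e12 eE.
  congr (_, _, _, _); apply/seteqP; split=> g.
    by move=> /(eE (n, G, k, v) (inr g)); rewrite e12 eE.
  by move=> /(eE (n', G', k', v') (inr g)); rewrite -e12 eE.
(* Finite graphs are listed by sequences, a countable type, so [nat] suffices for the codes. *)
apply: (@card_le_set_of_code L J c cinj hJ hrf (seq (nat * seq nat * nat)) _
  (fun s => [set` s]) pickle); first exact: pcan_inj pickleK.
by move=> n f [fn _ _]; apply/finite_seqP/(op_graph_finite c Lfin fn).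
Qed.
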